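(* Let $\Bbbk$ be an algebraically closed field of arbitrary characteristic, $V=\Bbbk^n$, $G=\mathrm{GL}(V)$ with its natural representation $\eta$ on $V$, and let $\underline{G}=G\ltimes_\eta V$ be the enhanced group, i.e. the variety $G\times V$ with product $(g_1,v_1)\cdot(g_2,v_2)=(g_1g_2,\ g_1v_2+v_1)$. Its Lie algebra is $\underline{\mathfrak g}=\mathfrak{gl}(V)\times V$, with adjoint action $\mathrm{Ad}(g,v)(X,w)=(\mathrm{Ad}(g)X,\ -(\mathrm{Ad}(g)X)v+gw)$, and its nilpotent cone is $\underline{\mathcal N}=\mathcal N\times V$, where $\mathcal N$ is the nilpotent cone of $\mathfrak{gl}(V)$. For a partition $\lambda$ of $n$ write $\lambda=(a_1\ge a_2\ge\cdots\ge a_t>0)=(b_1^{d_1}b_2^{d_2}\cdots b_r^{d_r})$ with $b_1>b_2>\cdots>b_r>0$, each $b_j$ occurring $d_j>0$ times, and set $d_0=0$. An enhanced partition of $n$ is a pair $\lambda[q]$ with $\lambda$ a partition of $n$ and $q\in\{d_0+d_1+\cdots+d_{j-1}\mid j=1,\dots,r+1\}$; let $\mathscr P_n^{e}$ denote the set of all enhanced partitions of $n$. Let $J_\lambda$ be the Jordan standard nilpotent matrix of type $\lambda$, with Jordan basis $\{J_\lambda^k v_i\mid 1\le i\le t,\ 0\le k\le a_i-1\}$ (so $J_\lambda^{a_i}v_i=0$), and put $u_j=v_{d_1+\cdots+d_j}$ for $j=1,\dots,r$ and $u_{r+1}=0$. For $q=d_0+\cdots+d_{j-1}$ let $\mathcal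 O_{\lambda[q]}$ be the $\underline G$-orbit of $(J_\lambda,u_j)$ in $\underline{\mathcal N}$ under the adjoint action (for $\lambda=(1^n)$, i.e. $J_\lambda=0$, this gives $\mathcal O_{(1^n)[0]}=\{0\}\times(V\setminus\{0\})$ and $\mathcal O_{(1^n)[n]}=\{(0,0)\}$). Then $\{\mathcal O_{\lambda[q]}\mid \lambda[q]\in\mathscr P_n^{e}\}$ is the complete set of nilpotent orbits in $\underline{\mathcal N}$ under the adjoint $\underline G$-action, these orbits being pairwise distinct; that is, the $\underline G$-orbits in $\underline{\mathcal N}$ are parameterized by the enhanced partitions of $n$, equivalently by the set $\{(\lambda,q)\mid \lambda=(b_1^{d_1}\cdots b_r^{d_r})\text{ a partition of } n,\ q=d_0+d_1+\cdots+d_{j-1},\ j=1,\dots,r+1\}$.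
   Context: Enhanced reductive group associated with the natural representation of $\mathrm{GL}_n$: $\underline G=\mathrm{GL}(V)\ltimes_\eta V$, $\underline{\mathfrak g}=\mathfrak{gl}(V)\times V$ with bracket $[(X_1,v_1),(X_2,v_2)]=([X_1,X_2],X_1v_2-X_2v_1)$; the ground field $\Bbbk$ is algebraically closed of any characteristic. *)

(* Defs.v *)
From HB Require Import structures.
From mathcomp Require Import all_boot all_order all_algebra.
Set Implicit Arguments. Unset Strict Implicit. Unset Printing Implicit Defensive.
Import GRing.Theory.
Local Open Scope ring_scope.

Definition is_partition (n : nat) (lam : seq nat) : bool :=
  [&& sumn lam == n, sorted geq lam & all (fun a => 0 < a)%N lam].

Definition parts_b (lam : seq nat) : seq nat := undup lam.
Definition mults_d (lam : seq nat) : seq nat :=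
  [seq count_mem b lam | b <- parts_b lam].

(* the admissible q's: d_0 + d_1 + ... + d_{j-1}, j = 1..r+1 (d_0 = 0);
   the (j-1)-th entry (0-indexed) of this list is the q attached to j *)
Definition enh_qs (lam : seq nat) : seq nat :=
  [seq sumn (take j (mults_d lam)) | j <- iota 0 (size (mults_d lam)).+1].

Definition enh_partition (n : nat) (lam : seq nat) (q : nat) : bool :=
  is_partition n lam && (q \in enh_qs lam).

(* Jordan standard nilpotent matrix of type lam (blocks in the order
   a_1, ..., a_t).  The i-th block (1-indexed) occupies coordinates
   s_i, ..., s_i + a_i - 1 where s_i = a_1 + ... + a_{i-1};
   v_i = e_{s_i} and J e_p = e_{p+1} inside a block, J e_p = 0 at the
   end of a block, so {J^k v_i | 0 <= k < a_i} is a Jordan basis. *)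
Definition block_starts (lam : seq nat) : seq nat :=
  [seq sumn (take i lam) | i <- iota 0 (size lam)].

Definition jordan_mx (k : nzRingType) (n : nat) (lam : seq nat) : 'M[k]_n :=
  \matrix_(r < n, c < n)
     ((r == c.+1 :> nat) && (nat_of_ord r \notin block_starts lam))%:R.

Definition ecol (k : nzRingType) (n p : nat) : 'cV[k]_n :=
  \col_(i < n) (i == p :> nat)%:R.

(* v_i (1-indexed i, 1 <= i <= t) *)
Definition vgen (k : nzRingType) (n : nat) (lam : seq nat) (i : nat) : 'cV[k]_n :=
  ecol k n (sumn (take i.-1 lam)).

Definition uvec (k : nzRingType) (n : nat) (lam : seq nat) (j : nat) : 'cV[k]_n :=
  if (0 < j <= size (mults_d lam))%N
  then vgen k n lam (sumn (take j (mults_d lam)))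
  else 0.

(* representative (J_lam, u_j) of O_{lam[q]}, where q = d_0 + ... + d_{j-1} *)
Definition enh_rep (k : nzRingType) (n : nat) (lam : seq nat) (q : nat)
  : 'M[k]_n * 'cV[k]_n :=
  (jordan_mx k n lam, uvec k n lam (index q (enh_qs lam)).+1).

Definition enh_Ad (k : fieldType) (n : nat) (g : 'M[k]_n) (v : 'cV[k]_n)
  (Xw : 'M[k]_n * 'cV[k]_n) : 'M[k]_n * 'cV[k]_n :=
  let AX := g *m Xw.1 *m invmx g in (AX, - (AX *m v) + g *m Xw.2).

Definition in_enh_orbit (k : fieldType) (n : nat) (x y : 'M[k]_n * 'cV[k]_n) : Prop :=
  exists (g : 'M[k]_n) (v : 'cV[k]_n), g \in unitmx /\ enh_Ad g v x = y.

Definition enh_nilcone (k : fieldType) (n : nat) (x : 'M[k]_n * 'cV[k]_n) : Prop :=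
  exists m : nat, x.1 ^+ m = 0.

(* Main.v *)
(** Write [im X] and [ker X] for the image and kernel of a nilpotent [X].  The vector part of the
    action translates [w] by [im X], so orbits over [X] are orbits of the centraliser of [X] on
    [V / im X].

    Existence.  A Jordan basis is built by repeatedly splitting off a cyclic subspace of maximal
    length, whose stable complement is cut out by one coordinate form and its translates by [X].
    Modulo [im X], [w] is a combination of the generators [v_i]; it is killed by [X ^+ a], with [a]
    the largest block size involved, and may replace the corresponding generator.

    Uniqueness.  The ranks of the powers of [X] determine [lam], and the least [m] such that [w]
    lies in [im X + ker X ^+ m] is [b_j] for [u_j] (and [0] for [u_(r+1)]). *)
Require Import Defs.
From HB Require Import structures.
From mathcomp Require Import all_boot all_order all_algebra.
From mathcomp Require Import zify.
Set Implicit Arguments. Unset Strict Implicit. Unset Printing Implicit Defensive.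
Import GRing.Theory.

(** * Partitions and block offsets *)

(** Entry [p] is the position of coordinate [p] inside its Jordan block; for positive parts, the
    zeros mark the block starts. *)
Definition block_offsets (lam : seq nat) : seq nat :=
  flatten [seq iota 0 a | a <- lam].

Lemma size_block_offsets lam : size (block_offsets lam) = sumn lam.
Proof.
by rewrite size_flatten /shape -map_comp (eq_map (size_iota 0)) map_id.
Qed.

Lemma block_starts_cons a lam :
  block_starts (a :: lam) = 0 :: map (addn a) (block_starts lam).
Proof.
rewrite /block_starts /= -(addn0 1) iotaDl -!map_comp.
by congr (_ :: _); apply: eq_map.
Qed.

Lemma mem_block_starts lam p : all (ltn 0) lam -> p < sumn lam ->
  (p \in block_starts lam) = (nth 0 (block_offsets lam) p == 0).
Proof.
elim: lam p => //= a lam IH p /andP[a0 pos] lp.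
rewrite block_starts_cons inE /block_offsets /= nth_cat size_iota.
have [pa|ap] := ltnP p a.
  rewrite nth_iota // add0n orbC; case: mapP => //= -[x _ E]; lia.
rewrite -IH //; last by lia.
have -> /= : (p == 0) = false by lia.
by rewrite -{1}(subnKC ap) mem_map //; exact: addnI.
Qed.

Lemma block_offsets_pred lam p : nth 0 (block_offsets lam) p.+1 != 0 ->
  nth 0 (block_offsets lam) p.+1 = (nth 0 (block_offsets lam) p).+1.
Proof.
elim: lam p => [|a lam IH] p; first by rewrite nth_nil.
rewrite /block_offsets /= !nth_cat !size_iota.
have [pa|ap] := ltnP p.+1 a; first by rewrite ltnW // !nth_iota //; lia.
have [pa|ap'] := ltnP p a.
  (* Coordinate [p.+1] opens the next nonempty block or lies past the end, where the default is 0;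
     either way its offset is 0, against the hypothesis. *)
  have -> : p.+1 - a = 0 by lia.
  by case: (lam) => [|[|b] l]//=; elim: l => [|[|c] l].
by rewrite subSn //; exact: IH.
Qed.

Lemma count_mem_block_offsets m lam :
  count_mem m (block_offsets lam) = count (ltn m) lam.
Proof.
rewrite count_flatten -map_comp -sumn_count; congr sumn; apply: eq_map => a /=.
by rewrite count_uniq_mem ?iota_uniq // mem_iota add0n.
Qed.

Lemma count_leq_eq (m : nat) s :
  count (leq m) s = count_mem m s + count (ltn m) s.
Proof. by elim: s => //= a s ->; lia. Qed.

(** Successive differences of the counts give the numbers of parts exceeding [m]; differencing once
    more gives the multiplicities. The counts will arise as ranks of powers of the Jordan matrix. *)
Lemma partition_eq_of_offsets lam1 lam2 :
    sorted geq lam1 -> sorted geq lam2 -> all (ltn 0) lam1 -> all (ltn 0) lam2 ->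
    (forall m, count (leq m) (block_offsets lam1) =
               count (leq m) (block_offsets lam2)) ->
  lam1 = lam2.
Proof.
move=> s1 s2 p1 p2 E.
have Elt m : count (ltn m) lam1 = count (ltn m) lam2.
  rewrite -!count_mem_block_offsets.
  by have := E m; have := E m.+1; rewrite !(count_leq_eq m) => -> /addIn.
apply: (sorted_eq _ _ s1 s2) => [x y z|x y|]; [rewrite /=; lia..|].
apply/allP => -[|m] _ /=; apply/eqP.
  by rewrite !(count_memPn _) //; apply/negP; [move/(allP p2)|move/(allP p1)].
apply: (@addIn (count (ltn m.+1) lam1)).
by rewrite {2}(Elt m.+1) -!count_leq_eq (Elt m).
Qed.

Lemma sumn_count_mem (T : eqType) (s t : seq T) : uniq t ->
  sumn [seq count_mem x s | x <- t] = count (mem t) s.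
Proof.
elim: t => [_|x t IH /= /andP[xt ut]]; first by rewrite /= count_pred0.
rewrite IH // -count_predUI addnC.
rewrite (@eq_count _ (predI _ _) pred0) ?count_pred0 => [|y /=]; last first.
  by case: eqP => [->|//]; rewrite (negPf xt).
by apply: eq_count => y; rewrite /= inE.
Qed.

Lemma undup_gt_sorted lam : sorted geq lam -> sorted gtn (undup lam).
Proof.
move=> s; have : sorted geq (undup lam).
  by apply: (subseq_sorted _ (undup_subseq _) s) => x y z /=; lia.
have := undup_uniq lam; case: (undup lam) => // a l.
elim: l a => //= b l IH a /andP[]; rewrite inE negb_or => /andP[ab al] u.
by case/andP=> ba p; apply/andP; split; [lia|exact: IH].
Qed.

(** The distinct parts decrease strictly, so the first [j.+1] of them are exactly those at least as
    large as the one at index [j]. *)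
Lemma sum_mults_take lam j : sorted geq lam -> j < size (parts_b lam) ->
  sumn (take j.+1 (mults_d lam)) = count (leq (nth 0 (parts_b lam) j)) lam.
Proof.
move=> s jl; rewrite /mults_d -map_take sumn_count_mem ?take_uniq ?undup_uniq //.
apply: eq_in_count => x xl /=.
have gt := undup_gt_sorted s; have xu : x \in undup lam by rewrite mem_undup.
have gtn_tr : transitive gtn by move=> u v w /=; lia.
have lei i i' : i < i' -> i' < size (undup lam) ->
    nth 0 (undup lam) i' < nth 0 (undup lam) i.
  move=> ii' i'l; apply: (sorted_ltn_nth gtn_tr 0 gt) => //.
  exact: ltn_trans ii' i'l.
rewrite in_take_leq // -index_mem in xu *.
rewrite -[in RHS](nth_index 0 (s := undup lam) (x := x)) -?index_mem //.
rewrite /parts_b in jl *.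
have [h|h|->] := ltngtP (index x (undup lam)) j.
- by rewrite ltnS (ltnW h) (ltnW (lei _ _ h jl)).
- by rewrite ltnS leqNgt h leqNgt (lei _ _ h xu).
- by rewrite ltnSn leqnn.
Qed.

(** The cut is at the last occurrence of [b]: the generator of that block is the vector [u_j] of the
    representative. *)
Lemma sorted_split_last b lam : sorted geq lam -> b \in lam ->
  exists s1 s2, [/\ lam = s1 ++ b :: s2, all (leq b) s1 & all (gtn b) s2].
Proof.
elim: lam => //= a lam IH p; have [bl _|bl] := boolP (b \in lam).
  have [s1 [s2 [-> h1 h2]]] := IH (path_sorted p) bl.
  exists (a :: s1), s2; split=> //=; rewrite h1 andbT.
  have : all (geq a) lam by apply: order_path_min p => x y z /=; lia.
  by move/allP/(_ _ bl).
rewrite inE (negPf bl) orbF => /eqP E; rewrite -E in p *.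
exists [::], lam; split=> //; apply/allP => x xl.
have : all (geq b) lam by apply: order_path_min p => u v w /=; lia.
move/allP/(_ _ xl) => /=; rewrite leq_eqVlt => /orP[/eqP e|//].
by rewrite -e xl in bl.
Qed.

Lemma block_offsets_split s1 b s2 i : i < b ->
  nth 0 (block_offsets (s1 ++ b :: s2)) (sumn s1 + i) = i.
Proof.
move=> ib; rewrite /block_offsets map_cat flatten_cat nth_cat.
rewrite -/(block_offsets s1) size_block_offsets ltnNge leq_addr /= addKn.
by rewrite nth_cat size_iota ib nth_iota.
Qed.

Lemma block_offsets_split_end s1 b s2 :
  nth 0 (block_offsets (s1 ++ b :: s2)) (sumn s1 + b) = 0.
Proof.
rewrite /block_offsets map_cat flatten_cat nth_cat.
rewrite -/(block_offsets s1) size_block_offsets ltnNge leq_addr /= addKn.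
rewrite nth_cat size_iota ltnn subnn.
by elim: s2 => [|[|c] l].
Qed.

Lemma size_mults_d lam : size (mults_d lam) = size (parts_b lam).
Proof. by rewrite size_map. Qed.

Lemma enh_qs_nth lam j : j <= size (mults_d lam) ->
  nth 0 (enh_qs lam) j = sumn (take j (mults_d lam)).
Proof. by move=> h; rewrite (nth_map 0) ?nth_iota ?size_iota. Qed.

(** Multiplicities are positive, so their partial sums increase strictly and [q] determines [j]. *)
Lemma enh_qs_index lam j : j <= size (mults_d lam) ->
  index (sumn (take j (mults_d lam))) (enh_qs lam) = j.
Proof.
have szq : size (enh_qs lam) = (size (mults_d lam)).+1.
  by rewrite size_map size_iota.
move=> jl; rewrite -enh_qs_nth // index_uniq ?szq //.
have posd : all (ltn 0) (mults_d lam).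
  apply/allP => _ /mapP[b bl ->]; rewrite /= -has_count has_pred1.
  by rewrite -mem_undup.
apply/(uniqP 0) => i i'; rewrite !inE szq !ltnS => il i'l.
rewrite !enh_qs_nth //.
have lt u v : u < v -> v <= size (mults_d lam) ->
    sumn (take u (mults_d lam)) < sumn (take v (mults_d lam)).
  elim: (mults_d lam) u v posd => [|d ds IH] [|u] [|v] //= /andP[d0 ds0] uv vl.
    by lia.
  by rewrite ltn_add2l IH.
by have [h|h|//] := ltngtP i i'; [have := lt _ _ h i'l|have := lt _ _ h il]; lia.
Qed.

Local Open Scope ring_scope.

(** * The Jordan matrix and the invariants of an orbit *)

Lemma block_offsets_le lam p : (nth 0 (block_offsets lam) p <= p)%N.
Proof.
elim: p => [|p IH].
  by rewrite leqn0; elim: lam => [|[|a] lam].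
have [->//|h] := eqVneq (nth 0 (block_offsets lam) p.+1) 0%N.
by rewrite block_offsets_pred.
Qed.

Section JordanMatrix.
Variables (k : fieldType) (n : nat) (lam : seq nat).
Hypothesis lamP : is_partition n lam.

Let sum_lam : sumn lam = n. Proof. by case/and3P: lamP => /eqP. Qed.
Let sorted_lam : sorted geq lam. Proof. by case/and3P: lamP. Qed.
Let pos_lam : all (ltn 0) lam. Proof. by case/and3P: lamP. Qed.

Local Notation off := (nth 0%N (block_offsets lam)).

Lemma jordan_mxE (r c : 'I_n) :
  jordan_mx k n lam r c = ((r == c.+1 :> nat) && (off r != 0))%:R.
Proof. by rewrite mxE mem_block_starts // sum_lam. Qed.

(** The [m]-th power moves [e_c] to [e_(c+m)] as long as both lie in one block, that is, as long as
    the target has offset at least [m]. *)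
Lemma jordan_mx_exp m (r c : 'I_n) :
  (jordan_mx k n lam ^+ m) r c = ((r == c + m :> nat)%N && (m <= off r)%N)%:R.
Proof.
elim: m r c => [|m IH] r c; first by rewrite expr0 mxE addn0 andbT.
rewrite exprS mxE; have [r0|r0] := posnP r.
  rewrite big1 => [|i _]; last by rewrite jordan_mxE r0 mul0r.
  by rewrite r0 addnS.
have lr : (r.-1 < n)%N by apply: leq_ltn_trans (ltn_ord r); exact: leq_pred.
rewrite (bigD1 (Ordinal lr)) //= big1 => [|i ni]; last first.
  rewrite jordan_mxE; case: eqP => [E|_]; last by rewrite mul0r.
  by case/eqP: ni; apply: val_inj; rewrite /= E.
rewrite addr0 jordan_mxE IH /= prednK // eqxx /=.
have := @block_offsets_pred lam r.-1; rewrite prednK //.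
case: eqP => [-> _|_ ->] //=; first by rewrite mul0r andbF.
by rewrite mul1r ltnS addnS -[in RHS](prednK r0) eqSS.
Qed.

Lemma jordan_mx_nilpotent : jordan_mx k n lam ^+ n = 0.
Proof.
apply/matrixP => r c; rewrite jordan_mx_exp mxE.
by case: eqP => // E; have := ltn_ord r; lia.
Qed.

(** The rows of offset at least [m] are distinct unit vectors, so the matrix [N] they form has its
    transpose as right inverse; all other rows vanish. *)
Lemma rank_jordan_mx_exp m :
  \rank (jordan_mx k n lam ^+ m) = count (leq m) (block_offsets lam).
Proof.
set M := _ ^+ m; pose P := [pred r : 'I_n | m <= off r]%N.
pose N : 'M_(#|P|, n) := rowsub (@enum_val _ P) M.
have offm (r : 'I_n) : r \in P -> (m <= r)%N.
  by move/leq_trans; apply; exact: block_offsets_le.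
have freeN : row_free N.
  apply/row_freeP; exists N^T; apply/matrixP => i j; rewrite !mxE.
  have Pi : (m <= off (enum_val i))%N := enum_valP i.
  have Pj : (m <= off (enum_val j))%N := enum_valP j.
  have lc : (enum_val i - m < n)%N.
    exact: leq_ltn_trans (leq_subr _ _) (ltn_ord _).
  rewrite (bigD1 (Ordinal lc)) //= big1 => [|c nc]; last first.
    rewrite !mxE jordan_mx_exp; case: eqP => [E|_]; last by rewrite mul0r.
    by case/eqP: nc; apply: val_inj; rewrite /= E addnK.
  rewrite addr0 !mxE !jordan_mx_exp /= Pi Pj subnK ?offm ?enum_valP //.
  rewrite eqxx mul1r andbT -(inj_eq enum_val_inj) eq_sym.
  by congr (_%:R : k); congr nat_of_bool.
have NM : (M :=: N)%MS.
  apply/eqmxP/andP; split; last first.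
    by apply/row_subP => i; rewrite row_rowsub row_sub.
  apply/row_subP => r; have [Pr|nPr] := boolP (r \in P).
    rewrite -(enum_rankK_in Pr Pr) -row_rowsub; exact: row_sub.
  rewrite (_ : row r M = 0) ?sub0mx //; apply/rowP => c.
  by rewrite mxE jordan_mx_exp mxE (negPf nPr : (m <= off r)%N = false) andbF.
rewrite NM (eqP freeN) cardE /enum_mem size_filter -enumT.
rewrite -[block_offsets lam in RHS](mkseq_nth 0%N) size_block_offsets sum_lam.
by rewrite /mkseq count_map -val_enum_ord count_map.
Qed.

(** The sum of the first [j.+1] multiplicities counts the blocks up to the last one of size [b]; the
    predecessor in [vgen] leaves exactly the blocks of [s1] to skip. *)
Lemma uvec_split s1 b s2 j : (j < size (parts_b lam))%N ->
    nth 0%N (parts_b lam) j = b ->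
    lam = s1 ++ b :: s2 -> all (leq b) s1 -> all (gtn b) s2 ->
  uvec k n lam j.+1 = ecol k n (sumn s1).
Proof.
move=> jl bj E h1 h2; rewrite /uvec size_mults_d jl /vgen /= sum_mults_take //.
rewrite bj E count_cat /= leqnn (eqP (etrans (esym (all_count _ _)) h1)).
rewrite (_ : count _ s2 = 0%N) ?addn0 ?addn1 /= ?take_size_cat //.
by apply/eqP; rewrite -leqn0 leqNgt -has_count -all_predC (sub_all _ h2) // => x /=; lia.
Qed.

Lemma jordan_exp_ecol m p : (p < n)%N ->
  jordan_mx k n lam ^+ m *m ecol k n p =
  \col_r ((r == p + m :> nat)%N && (m <= off r)%N)%:R.
Proof.
move=> pn; apply/colP => r; rewrite mxE (bigD1 (Ordinal pn)) //= big1 => [|i ni].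
  by rewrite !mxE jordan_mx_exp /= eqxx mulr1 addr0.
by rewrite [ecol _ _ _ _ _]mxE -[p]/(val (Ordinal pn)) (inj_eq val_inj) (negPf ni) mulr0.
Qed.

End JordanMatrix.

Definition in_im_plus_ker (k : fieldType) n m (x : 'M[k]_n * 'cV[k]_n) : Prop :=
  exists y z, x.2 = x.1 *m y + z /\ x.1 ^+ m *m z = 0.

Lemma conjmx_exp (k : fieldType) n (g X : 'M[k]_n) m : g \in unitmx ->
  (g *m X *m invmx g) ^+ m = g *m X ^+ m *m invmx g.
Proof.
move=> gu; elim: m => [|m IH]; first by rewrite !expr0 -[1]/1%:M mulmx1 mulmxV.
by rewrite !exprS IH -!mulmxE !mulmxA mulmxKV.
Qed.

(** Conjugation carries images and kernels along, and the translation only adds an element of the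
    image, absorbed by [y]. *)
Lemma in_im_plus_ker_Ad (k : fieldType) n m (g : 'M[k]_n) v x : g \in unitmx ->
  in_im_plus_ker m x <-> in_im_plus_ker m (enh_Ad g v x).
Proof.
move=> gu; case: x => X w; split=> -[y [z /= [E Z]]].
  exists (g *m y - v), (g *m z); rewrite /= conjmx_exp // !mulmxA mulmxKV //.
  split; last by rewrite -mulmxA Z mulmx0.
  by rewrite E !mulmxBr mulmxDr !mulmxA mulmxKV // addrA [- _ + _]addrC.
exists (invmx g *m (y + v)), (invmx g *m z); split.
  apply: (can_inj (mulKmx gu)); rewrite mulmxDr !mulmxA mulmxV // mul1mx.
  by rewrite mulmxDr addrAC -E addrAC addNr add0r.
move: Z; rewrite conjmx_exp // => /(congr1 (mulmx (invmx g))).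
by rewrite !mulmxA mulVmx // mul1mx mulmx0.
Qed.

Lemma in_im_plus_ker_rep (k : fieldType) n lam j m : is_partition n lam ->
    (j <= size (parts_b lam))%N ->
  in_im_plus_ker m (jordan_mx k n lam, uvec k n lam j.+1) <->
  (nth 0 (parts_b lam) j <= m)%N.
Proof.
move=> lamP; case: ltngtP => // [jl|jl] _; last first.
  (* Here [j] is the number of distinct parts: the vector is 0, and so is the default value of
     [nth]. *)
  rewrite nth_default ?jl //; split=> // _; exists 0, 0.
  by rewrite !mulmx0 addr0 /uvec size_mults_d -jl ltnn andbF.
have [/eqP sn sorted_lam pos] := and3P lamP.
set b := nth _ _ _; have bl : b \in lam by rewrite -mem_undup mem_nth.
have b0 : (0 < b)%N by apply: (allP pos).
have [s1 [s2 [E h1 h2]]] := sorted_split_last sorted_lam bl.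
rewrite (uvec_split _ lamP jl (erefl _) E h1 h2).
have sb : (sumn s1 + b <= n)%N.
  by rewrite -sn E sumn_cat /= addnA leq_addr.
have s1n : (sumn s1 < n)%N by lia.
split=> [[y [z /= [eqw Z]]]|bm].
  (* If [m < b], applying the [m]-th power to [w = X y + z] leaves [X ^+ m.+1 *m y]. Coordinate
     [sumn s1 + m] has offset [m], so it is 1 on the left and 0 on the right. *)
  rewrite leqNgt; apply/negP => mb.
  have lr : (sumn s1 + m < n)%N by lia.
  have := congr1 (fun w => (jordan_mx k n lam ^+ m *m w) (Ordinal lr) 0) eqw.
  rewrite mulmxDr Z addr0 mulmxA mulmxE -exprSr jordan_exp_ecol //.
  rewrite !mxE big1 /= => [|c _].
    rewrite eqxx E block_offsets_split // leqnn => /eqP; by rewrite oner_eq0.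
  rewrite jordan_mx_exp //= [in X in (_ <= X)%N]E block_offsets_split //.
  by rewrite ltnn andbF mul0r.
exists 0, (ecol k n (sumn s1)); split; first by rewrite mulmx0 add0r.
rewrite /= -(subnK bm) exprD -mulmxE -mulmxA jordan_exp_ecol //.
rewrite (_ : \col__ _ = 0) ?mulmx0 //; apply/colP => r; rewrite !mxE.
case: eqP => //= ->; rewrite E block_offsets_split_end leqNgt b0 //.
Qed.

Lemma enh_rep_distinct (k : fieldType) n lam1 lam2 q1 q2 :
    enh_partition n lam1 q1 -> enh_partition n lam2 q2 ->
    in_enh_orbit (enh_rep k n lam1 q1) (enh_rep k n lam2 q2) ->
  lam1 = lam2 /\ q1 = q2.
Proof.
case/andP=> P1 Q1 /andP[P2 Q2] [g [v [gu Ead]]].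
have [/eqP _ s1 p1] := and3P P1; have [/eqP _ s2 p2] := and3P P2.
have El : lam1 = lam2.
  apply: partition_eq_of_offsets => // m.
  have := congr1 (fun x => \rank (x.1 ^+ m)) Ead.
  rewrite /= conjmx_exp // mxrankMfree ?row_free_unit ?unitmx_inv //.
  rewrite (eqmxMfull _ (_ : row_full g)) ?row_full_unit //.
  by rewrite !rank_jordan_mx_exp.
split=> //; subst lam2.
have qle q : q \in enh_qs lam1 -> (index q (enh_qs lam1) <= size (parts_b lam1))%N.
  by rewrite -index_mem size_map size_iota size_mults_d.
have [i1 i2] := (qle _ Q1, qle _ Q2).
have Einv m : (nth 0 (parts_b lam1) (index q1 (enh_qs lam1)) <= m)%N <->
              (nth 0 (parts_b lam1) (index q2 (enh_qs lam1)) <= m)%N.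
  have H := in_im_plus_ker_Ad m v (enh_rep k n lam1 q1) gu.
  by rewrite Ead in H; split=> h; apply/(in_im_plus_ker_rep k m P1 _)/H => //;
     apply/(in_im_plus_ker_rep k m P1 _).
have Eb : nth 0%N (parts_b lam1) (index q1 (enh_qs lam1)) =
          nth 0%N (parts_b lam1) (index q2 (enh_qs lam1)).
  by apply/eqP; rewrite eqn_leq (Einv _).2 // (Einv _).1.
(* Parts are positive, so the distinct parts followed by 0 are still distinct, and the value of the
   invariant determines the index [j], including the last one. *)
have u : uniq (rcons (parts_b lam1) 0%N).
  rewrite rcons_uniq undup_uniq andbT mem_undup.
  by apply/negP => /(allP p1).
have nr i : nth 0%N (rcons (parts_b lam1) 0%N) i = nth 0%N (parts_b lam1) i.
  rewrite nth_rcons; case: ltngtP => // h; rewrite nth_default //; first exact: ltnW.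
  by rewrite h.
rewrite -(nth_index 0%N Q1) -(nth_index 0%N Q2); congr nth.
apply/eqP; rewrite -(nth_uniq 0%N _ _ u) ?size_rcons ?ltnS // !nr.
by apply/eqP.
Qed.

(** * Jordan bases *)

Section Chains.
Variables (k : fieldType) (n : nat) (X : 'M[k]_n).
Implicit Types (x : nat * 'cV[k]_n) (L : seq (nat * 'cV[k]_n)).

(** A chain is encoded by its length and its generator. Linear independence is expressed later by
    comparing total length with the dimension of the span. *)
Definition chain x : seq 'cV[k]_n := [seq X ^+ i *m x.2 | i <- iota 0 x.1].
Definition chains L : seq 'cV[k]_n := flatten [seq chain x | x <- L].
Definition is_chain x : bool := X ^+ x.1 *m x.2 == 0.

Lemma size_chain x : size (chain x) = x.1.
Proof. by rewrite size_map size_iota. Qed.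

Lemma chains_cons x L : chains (x :: L) = chain x ++ chains L.
Proof. by []. Qed.

Lemma size_chains L : size (chains L) = sumn (map fst L).
Proof. by rewrite size_flatten /shape -map_comp (eq_map size_chain). Qed.

Lemma is_chain_exp x m : is_chain x -> (x.1 <= m)%N -> X ^+ m *m x.2 = 0.
Proof.
move=> /eqP h le; rewrite -(subnK le) exprD -mulmxE -mulmxA h.
by rewrite mulmx0.
Qed.

Lemma mem_span_chain x i : is_chain x -> X ^+ i *m x.2 \in <<chain x>>%VS.
Proof.
move=> h; have [lt|le] := ltnP i x.1; last by rewrite is_chain_exp // mem0v.
by apply/memv_span/map_f; rewrite mem_iota.
Qed.

Lemma span_chain_sub x (U : {vspace 'cV[k]_n}) :
  (forall i, X ^+ i *m x.2 \in U) -> (<<chain x>> <= U)%VS.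
Proof. by move=> h; apply/span_subvP => _ /mapP[i _ ->]. Qed.

(** Every vector of a chain except its generator lies in the image of [X]. *)
Lemma span_chain_mod_im x u : u \in <<chain x>>%VS ->
  exists c y, u = c *: x.2 + X *m y.
Proof.
have sub : (<<chain x>> <= <[x.2]> + limg (linfun (mulmx X)))%VS.
  apply: span_chain_sub => -[|i].
    by rewrite expr0 -[1]/1%:M mul1mx (subvP (addvSl _ _)) ?memv_line.
  rewrite exprS -mulmxE -mulmxA (subvP (addvSr _ _)) //.
  by apply/memv_imgP; exists (X ^+ i *m x.2); rewrite ?memvf ?lfunE.
move/(subvP sub)/memv_addP => [_ /vlineP[c ->] [_ /memv_imgP[y _ ->] ->]].
by exists c, y; rewrite lfunE.
Qed.

Lemma span_chains_perm L L' : perm_eq L L' ->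
  <<chains L>>%VS = <<chains L'>>%VS.
Proof.
by move=> p; apply/eq_span/perm_mem/perm_flatten/perm_map.
Qed.

(* A combination of generators whose heaviest term is [(a, v)] is killed by [X ^+ a], so it can
   replace [v]. *)
Lemma generator_exchange L w : all is_chain L -> w \in <<chains L>>%VS ->
  (exists y, w = X *m y) \/
  exists x L', [/\ perm_eq (map fst L) (map fst (x :: L')),
    exists y, w = X *m y + x.2, all is_chain (x :: L')
    & (<<chains L>> <= <<chains (x :: L')>>)%VS].
Proof.
elim: L w => [|[a v] L IH] w.
  by rewrite span_nil memv0 => _ /eqP->; left; exists 0; rewrite mulmx0.
case/andP=> hx hL; rewrite chains_cons span_cat.
case/memv_addP=> u1 /span_chain_mod_im[c [y1 E1]] [u2 /(IH _ hL) D E].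
have {E1 E} -> : w = X *m y1 + (c *: v + u2) by rewrite E E1 addrCA addrA.
(* If [c = 0], the generator [v] is absent from [w] modulo the image, and the exchange happens
   inside the tail. *)
have [->|c0] := eqVneq c 0.
  case: D => [[y ->]|[x [L' [p [y ->] h s]]]].
    by left; exists (y1 + y); rewrite scale0r add0r mulmxDr.
  right; exists x, ((a, v) :: L'); split.
  - apply: perm_trans (_ : perm_eq (a :: map fst (x :: L')) _).
      by rewrite /= perm_cons.
    exact: permEl (perm_catCA [:: a] [:: x.1] _).
  - by exists (y1 + y); rewrite scale0r add0r mulmxDr addrA.
  - by move: h => /= /andP[-> ->]; rewrite hx.
  - rewrite !chains_cons !span_cat subv_add (subv_trans (addvSl _ _) (addvSr _ _)).
    by apply: subv_trans s _; rewrite chains_cons span_cat addvS ?addvSr.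
have hcv : is_chain (a, c *: v).
  by rewrite /is_chain /= -scalemxAr (eqP (hx : _ *m _ == 0)) scaler0.
case: D => [[y ->]|[[b v2] [L' [p [y ->] /andP[h2 h] s]]]].
  right; exists (a, c *: v), L; split=> //; last 2 first.
  - by rewrite /= hcv.
  - rewrite chains_cons !span_cat addvS // span_chain_sub // => i.
    have -> : X ^+ i *m v = c^-1 *: (X ^+ i *m (c *: v)) by rewrite -scalemxAr scalerK.
    rewrite rpredZ //.
    exact: (mem_span_chain (x := (a, _))).
  - by exists (y1 + y); rewrite mulmxDr -addrA [c *: v + _]addrC addrA.
have E : X *m y1 + (c *: v + (X *m y + v2)) = X *m (y1 + y) + (c *: v + v2).
  by rewrite mulmxDr -!addrA; congr (_ + _); rewrite addrCA.
(* The sum [c *: v + v2] is killed by the power for the longer chain, so it replaces [v2] when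
   [a <= b] and [v] otherwise; the replaced generator is recovered by subtraction, using [c != 0] in
   the second case. *)
have [ab|ba] := leqP a b.
  right; exists (b, c *: v + v2), ((a, v) :: L').
  have hn : is_chain (b, c *: v + v2).
    apply/eqP; rewrite /= mulmxDr (is_chain_exp h2) // addr0.
    exact: (is_chain_exp hcv).
  split; [|by exists (y1 + y)|by apply/and3P|].
  - apply: perm_trans (_ : perm_eq (a :: map fst ((b, v2) :: L')) _).
      by rewrite /= perm_cons.
    exact: permEl (perm_catCA [:: a] [:: b] _).
  rewrite !chains_cons !span_cat; apply: subv_trans (addvS (subvv _) s) _.
  rewrite chains_cons span_cat subv_add (subv_trans (addvSl _ _) (addvSr _ _)) /=.
  rewrite subv_add andbC (subv_trans (addvSr _ _) (addvSr _ _)) /=.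
  apply: span_chain_sub => i /=.
  have -> : X ^+ i *m v2 = X ^+ i *m (c *: v + v2) - c *: (X ^+ i *m v).
    by rewrite mulmxDr -scalemxAr addrAC subrr add0r.
  rewrite rpredB ?rpredZ //.
    by apply: (subvP (addvSl _ _)); exact: (mem_span_chain (x := (b, _))).
  apply: (subvP (addvSr _ _)); apply: (subvP (addvSl _ _)).
  exact: (mem_span_chain (x := (a, _))).
right; exists (a, c *: v + v2), ((b, v2) :: L').
have hn : is_chain (a, c *: v + v2).
  apply/eqP; rewrite /= mulmxDr (is_chain_exp h2) ?(ltnW ba) // addr0.
  exact: (is_chain_exp hcv).
split; [by rewrite /= perm_cons|by exists (y1 + y)|by apply/and3P|].
rewrite !chains_cons !span_cat; apply: subv_trans (addvS (subvv _) s) _.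
rewrite chains_cons span_cat subv_add addvSr andbT.
apply: span_chain_sub => i /=.
have -> : X ^+ i *m v = c^-1 *: (X ^+ i *m (c *: v + v2) - X ^+ i *m v2).
  by rewrite mulmxDr addrK -scalemxAr scalerK.
rewrite rpredZ ?rpredB //.
  by apply: (subvP (addvSl _ _)); exact: (mem_span_chain (x := (a, _))).
apply: (subvP (addvSr _ _)); apply: (subvP (addvSl _ _)).
exact: (mem_span_chain (x := (b, _))).
Qed.

(** The matrix is triangular with respect to the antidiagonal, on which it is constantly
    [h m.-1]. *)
Lemma hankel_unit m (h : nat -> k) : h m.-1 != 0 ->
    (forall i, (m <= i)%N -> h i = 0) ->
  \matrix_(i < m, j < m) h (i + j)%N \in unitmx.
Proof.
move=> hm h0; rewrite -row_free_unit; apply: inj_row_free => v vH.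
suff E d (i : 'I_m) : (i < d)%N -> v 0 i = 0.
  by apply/rowP => i; rewrite mxE (E i.+1).
elim: d i => // d IH i; rewrite ltnS => id.
(* Column [m.-1 - i] isolates [v 0 i]: earlier terms vanish by induction, later ones lie beyond the
   antidiagonal. *)
have lj : (m.-1 - i < m)%N by have := ltn_ord i; lia.
have := congr1 (fun r : 'rV_m => r 0 (Ordinal lj)) vH.
rewrite !mxE (bigD1 i) //= big1 => [|i' ni].
  rewrite mxE /= subnKC ?addr0 => [/eqP|]; last by have := ltn_ord i; lia.
  by rewrite mulf_eq0 (negPf hm) orbF => /eqP.
rewrite mxE /=; have [lt|le] := ltnP i' i.
  by rewrite (IH i') ?mul0r //; exact: leq_trans lt id.
rewrite h0 ?mulr0 //.
have ne : (i' != i :> nat) := ni.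
by have := ltn_ord i; lia.
Qed.

(* Given [v] in [U] with [X ^+ m.-1 *m v != 0], [m] maximal, and a coordinate [e] that does not
   vanish there, the vectors [u] of [U] with all [X ^+ i *m u] of zero [e]-coordinate form a stable
   complement of the chain of [v]. *)
Lemma cyclic_complement (U : {vspace 'cV[k]_n}) N : X ^+ N = 0 ->
    (forall u, u \in U -> X *m u \in U) -> U != 0%VS ->
  exists x (W : {vspace 'cV[k]_n}), [/\ is_chain x, (0 < x.1)%N,
    forall u, u \in W -> X *m u \in W,
    U = (<<chain x>> + W)%VS & \dim U = (x.1 + \dim W)%N].
Proof.
move=> XN sU U0.
(* The least [m] with [P m] is the nilpotency index of [X] on [U], the maximal length of a chain in
   [U]. *)
pose P m := (U <= lker (linfun (mulmx (X ^+ m) : 'cV_n -> 'cV_n)))%VS.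
have exP : exists m, P m.
  by exists N; apply/subvP => u _; rewrite memv_ker lfunE /= XN mul0mx.
case: (ex_minnP exP) => m Pm minm.
have m0 : (0 < m)%N.
  rewrite lt0n; apply/eqP => mE; case/negP: U0; rewrite -subv0.
  apply/subvP => u /(subvP Pm); rewrite memv_ker lfunE /= mE expr0.
  by rewrite -[1]/1%:M mul1mx memv0.
have kill u i : u \in U -> (m <= i)%N -> X ^+ i *m u = 0.
  move=> uU mi; rewrite -(subnK mi) exprD -mulmxE -mulmxA.
  by move/(subvP Pm): uU; rewrite memv_ker lfunE => /= /eqP->; rewrite mulmx0.
have : ~~ P m.-1 by apply/negP => /minm; lia.
case/subvPn=> v vU; rewrite memv_ker lfunE /= => nz.
have [e nze] : exists e, (X ^+ m.-1 *m v) e 0 != 0.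
  apply/existsP; apply: contraR nz => /existsPn z; apply/eqP/colP => e.
  by rewrite [RHS]mxE; apply/eqP; rewrite -[_ == _]negbK z.
(* [T] collects the forms taking [u] to the [e]-coordinate of [X ^+ i *m u], and [B] has the chain
   of [v] as columns; [T *m B] is then a Hankel matrix. *)
pose T : 'M[k]_(m, n) := \matrix_(i, j) (X ^+ i) e j.
pose B : 'M[k]_(n, m) := \matrix_(i, j) (X ^+ j *m v) i 0.
have TE u i : (T *m u) i 0 = (X ^+ i *m u) e 0.
  by rewrite !mxE; apply: eq_bigr => j _; rewrite mxE.
have sXU i : X ^+ i *m v \in U.
  elim: i => [|i IH]; first by rewrite expr0 -[1]/1%:M mul1mx.
  by rewrite exprS -mulmxE -mulmxA sU.
have cU : (<<chain (m, v)>> <= U)%VS by apply: span_chain_sub.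
have BE (c : 'cV_m) : B *m c \in <<chain (m, v)>>%VS.
  have -> : B *m c = \sum_j c j 0 *: (X ^+ j *m v).
    apply/colP => i; rewrite mxE summxE; apply: eq_bigr => j _.
    by rewrite [B _ _]mxE [in RHS]mxE mulrC.
  apply: rpred_sum => j _; apply/rpredZ/memv_span/mapP.
  by exists (j : nat); rewrite ?mem_iota /=.
have TBu : T *m B \in unitmx.
  have -> : T *m B = \matrix_(i, j) (X ^+ (i + j) *m v) e 0.
    apply/matrixP => i j; rewrite [RHS]mxE exprD -mulmxE -mulmxA -TE !mxE.
    by apply: eq_bigr => l _; congr (_ * _); rewrite mxE.
  apply: (@hankel_unit m (fun i => (X ^+ i *m v) e 0)) => // i mi.
  by rewrite kill // mxE.
pose fT := linfun (mulmx T : 'cV_n -> 'cV_m).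
have surj c : fT (B *m (invmx (T *m B) *m c)) = c.
  by rewrite lfunE /= !mulmxA mulmxV // mul1mx.
exists (m, v), (U :&: lker fT)%VS; split=> //.
- by apply/eqP/kill.
(* Passing from [u] to [X *m u] shifts the forms by one; the form that leaves the range involves
   [X ^+ m], which kills [U]. *)
- move=> u; rewrite !memv_cap !memv_ker !lfunE /= => /andP[uU /eqP Tu].
  rewrite sU //=; apply/eqP/colP => i; rewrite TE mulmxA mulmxE -exprSr [RHS]mxE.
  have [lt|le] := ltnP i.+1 m; last by rewrite kill // mxE.
  by have := congr1 (fun c : 'cV_m => c (Ordinal lt) 0) Tu;
  rewrite TE => ->; rewrite mxE.
- apply/eqP; rewrite eqEsubv; apply/andP; split; last first.
    by rewrite subv_add cU capvSl.
  (* [b] is the projection of [u] onto the chain along the kernel of [T]. *)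
  apply/subvP => u uU; set b := B *m (invmx (T *m B) *m fT u).
  have bU : b \in U by exact: (subvP cU _ (BE _)).
  rewrite -(subrK b u) addrC memv_add ?BE // memv_cap rpredB //=.
  by rewrite memv_ker linearB /= surj subrr.
- rewrite -(limg_ker_dim fT U) addnC; congr (_ + _)%N => /=.
  suff -> : (fT @: U)%VS = fullv by rewrite dimvf /dim /= muln1.
  apply/eqP; rewrite eqEsubv subvf; apply/subvP => c _.
  by apply/memv_imgP; exists (B *m (invmx (T *m B) *m c)); rewrite ?surj ?(subvP cU).
Qed.

(** Induction on the dimension: the complement is stable and strictly smaller because the chain is
    nonempty. The last equality makes the listed vectors a basis. *)
Lemma chain_decomposition (U : {vspace 'cV[k]_n}) N : X ^+ N = 0 ->
    (forall u, u \in U -> X *m u \in U) ->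
  exists L, [/\ all is_chain L, all (ltn 0) (map fst L),
    <<chains L>>%VS = U & sumn (map fst L) = \dim U].
Proof.
move=> XN; have [d] := ubnP (\dim U); elim: d U => // d IH U Ud sU.
have [->|U0] := eqVneq U 0%VS.
  by exists [::]; rewrite span_nil dimv0.
have [x [W [hx x0 sW EU dU]]] := cyclic_complement XN sU U0.
have [|L [hL L0 EL dL]] := IH W _ sW; first by move: Ud; rewrite dU; lia.
exists (x :: L); split=> //=; [by rewrite hx|by rewrite x0| |].
- by rewrite chains_cons span_cat EL -EU.
- by rewrite dL -dU.
Qed.

Definition chains_mx L : 'M[k]_n := \matrix_(i, j) (nth 0 (chains L) j) i 0.

Lemma chains_mx_ecol L p : (p < n)%N -> chains_mx L *m ecol k n p = nth 0 (chains L) p.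
Proof.
move=> pn; apply/colP => i; rewrite mxE (bigD1 (Ordinal pn)) //= big1 => [|j nj].
  by rewrite !mxE /= eqxx mulr1 addr0.
by rewrite [ecol _ _ _ _ _]mxE -[p]/(val (Ordinal pn)) (inj_eq val_inj) (negPf nj) mulr0.
Qed.

(** The columns span everything, so a right inverse can be assembled from chosen preimages of the
    standard basis vectors. *)
Lemma chains_mx_unit L : <<chains L>>%VS = fullv -> sumn (map fst L) = n ->
  chains_mx L \in unitmx.
Proof.
move=> EL sL; set g := chains_mx L.
have img : limg (linfun (mulmx g : 'cV_n -> 'cV_n)) = fullv.
  apply/eqP; rewrite eqEsubv subvf -{1}EL; apply/span_subvP => u uL.
  have lt : (index u (chains L) < n)%N.
    by have := uL; rewrite -index_mem size_chains sL.
  apply/memv_imgP; exists (ecol k n (index u (chains L))); rewrite ?memvf //.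
  by rewrite lfunE /= chains_mx_ecol // nth_index.
have pre j : {c : 'cV[k]_n | g *m c == col j 1%:M}.
  apply: sigW; have : col j 1%:M \in limg (linfun (mulmx g : 'cV_n -> 'cV_n)).
    by rewrite img memvf.
  by case/memv_imgP => c _ ->; exists c; rewrite lfunE.
suff : g *m (\matrix_(i, j) sval (pre j) i 0) = 1%:M by case/mulmx1_unit.
apply/matrixP => i j; have /eqP E := svalP (pre j).
move/(congr1 (fun c : 'cV_n => c i 0)): E; rewrite !mxE => <-.
by apply: eq_bigr => l _; congr (_ * _); rewrite mxE.
Qed.

(** The chains follow the block layout: a zero offset at [p.+1] signals that position [p] ends its
    chain. *)
Lemma nth_chains_step L p : all is_chain L -> all (ltn 0) (map fst L) ->
  X *m nth 0 (chains L) p =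
  if nth 0%N (block_offsets (map fst L)) p.+1 == 0%N then 0
  else nth 0 (chains L) p.+1.
Proof.
elim: L p => [|[a v] L IH] p; first by rewrite !nth_nil mulmx0.
case/andP=> hx hL /= /andP[a0 L0].
rewrite chains_cons /block_offsets /= -/(block_offsets _) !nth_cat size_chain size_iota /=.
have cE i : (i < a)%N -> nth 0 (chain (a, v)) i = X ^+ i *m v.
  by move=> ia; rewrite (nth_map 0%N) ?size_iota // nth_iota.
have [pa|ap] := ltnP p.+1 a.
  by rewrite (ltnW pa) nth_iota // !cE ?(ltnW pa) // mulmxA mulmxE -exprS.
have [pa|ap'] := ltnP p a; last by rewrite subSn // IH.
have Ea : p.+1 = a by lia.
rewrite Ea subnn cE // mulmxA mulmxE -exprS Ea (eqP (hx : _ *m _ == 0)).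
by case: (L) L0 => [|[[|b] v'] L'].
Qed.

Lemma chains_mx_conj L : all is_chain L -> all (ltn 0) (map fst L) ->
    sumn (map fst L) = n ->
  X *m chains_mx L = chains_mx L *m jordan_mx k n (map fst L).
Proof.
move=> hL L0 sL; apply/matrixP => i j.
have -> : (X *m chains_mx L) i j = (X *m nth 0 (chains L) j) i 0.
  by rewrite !mxE; apply: eq_bigr => l _; rewrite mxE.
rewrite nth_chains_step // mxE; have [jn|nj] := ltnP j.+1 n; last first.
  rewrite [block_offsets _ in X in nth _ X]/block_offsets nth_default ?mxE; last first.
    by rewrite size_block_offsets sL.
  rewrite big1 // => l _; rewrite [jordan_mx _ _ _ _ _]mxE.
  by case: eqP => [E|]; rewrite ?mulr0 //; have := ltn_ord l; lia.
rewrite (bigD1 (Ordinal jn)) //= big1 => [|l nl]; last first.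
  rewrite [jordan_mx _ _ _ _ _]mxE -[j.+1]/(val (Ordinal jn)) (inj_eq val_inj).
  by rewrite (negPf nl) mulr0.
rewrite addr0 !mxE /= eqxx mem_block_starts ?sL //.
by case: eqP; rewrite ?mulr0 ?mulr1 ?mxE.
Qed.

End Chains.

(** * Orbits *)

Lemma orbit_of_chains (k : fieldType) n (X : 'M[k]_n) (w y : 'cV[k]_n)
    (L : seq (nat * 'cV[k]_n)) j :
    is_partition n (map fst L) -> all (is_chain X) L ->
    <<chains X L>>%VS = fullv -> (j <= size (parts_b (map fst L)))%N ->
    w = X *m y + chains_mx X L *m uvec k n (map fst L) j.+1 ->
  exists lam q, enh_partition n lam q /\ in_enh_orbit (enh_rep k n lam q) (X, w).
Proof.
move=> lamP hL EL jl Ew; have [/eqP sn _ pos] := and3P lamP.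
set lam := map fst L in lamP sn pos jl Ew *.
rewrite -size_mults_d in jl.
have gu := chains_mx_unit EL sn; set g := chains_mx X L in gu Ew.
exists lam, (sumn (take j (mults_d lam))); split.
  rewrite /enh_partition lamP -enh_qs_nth // mem_nth // size_map size_iota.
  by rewrite ltnS.
(* The action translates by minus the image of its vector, so [- y] contributes [X *m y]. *)
exists g, (- y); split=> //.
have XE : g *m jordan_mx k n lam *m invmx g = X.
  by rewrite -chains_mx_conj // mulmxK.
by rewrite /enh_rep enh_qs_index // /enh_Ad [fst _]/= XE mulmxN opprK -Ew.
Qed.

Lemma sort_chains_sorted (T : Type) (L : seq (nat * T)) :
  sorted geq (map fst (sort (relpre fst geq) L)).
Proof.
by rewrite sorted_map; apply: sort_sorted => x y /=; lia.
Qed.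

Lemma enh_rep_surjective (k : fieldType) n (x : 'M[k]_n * 'cV[k]_n) :
    enh_nilcone x ->
  exists lam q, enh_partition n lam q /\ in_enh_orbit (enh_rep k n lam q) x.
Proof.
case: x => X w [N /= XN].
have [L [hL pos EL sL]] := chain_decomposition XN (fun u _ => memvf (X *m u)).
have {}sL : sumn (map fst L) = n by rewrite sL dimvf /dim /= muln1.
have wL : w \in <<chains X L>>%VS by rewrite EL memvf.
case: (generator_exchange hL wL) => [[y Ew]|[x [L' [pL [y Ew] hL' subL]]]].
  set L' := sort (relpre fst geq) L.
  have p : perm_eq L' L by rewrite perm_sort.
  apply: (@orbit_of_chains _ _ _ _ y L' (size (parts_b (map fst L')))) => //.
  - rewrite /is_partition sort_chains_sorted (perm_sumn (perm_map _ p)) sL.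
    by rewrite (perm_all _ (perm_map fst p)) pos eqxx.
  - by rewrite (perm_all _ p).
  - by rewrite (span_chains_perm X p).
  - by rewrite /uvec size_mults_d ltnn andbF mulmx0 addr0.
have [b Eb] : exists b, x.1 = b by exists x.1.
(* The chain [x] is placed after all other chains of length at least [b], hence last among those of
   length [b], so that its generator becomes [u_j]. *)
pose S := sort (relpre fst geq) L'.
pose S1 := [seq z <- S | b <= z.1]%N; pose S2 := [seq z <- S | ~~ (b <= z.1)]%N.
pose L2 := S1 ++ x :: S2.
have p : perm_eq L2 (x :: L').
  rewrite perm_catC /= perm_cons perm_catC perm_filterC; exact/permPl/perm_sort.
have pf : perm_eq (map fst L2) (map fst L).
  by apply: perm_trans (perm_map fst p) _; rewrite perm_sym.
have h1 : all (leq b) (map fst S1) by rewrite all_map filter_all.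
have h2 : all (gtn b) (map fst S2).
  by rewrite all_map; apply: sub_all (filter_all _ _) => z /=; rewrite -ltnNge.
have E2 : map fst L2 = map fst S1 ++ b :: map fst S2 by rewrite map_cat /= Eb.
have geq_tr : transitive geq by move=> u v z /=; lia.
have sS : sorted geq (map fst L2).
  have sS : sorted (relpre fst geq) S by rewrite -sorted_map sort_chains_sorted.
  have tr : transitive (relpre fst geq : rel (nat * 'cV[k]_n)).
    by move=> u v z; exact: geq_tr.
  rewrite E2 sorted_pairwise // pairwise_cat /= -!sorted_pairwise //.
  rewrite !sorted_map !(sorted_filter tr) // andbT.
  apply/and3P; split=> //; last by apply: sub_all h2 => z /=; exact: ltnW.
  apply/allrelP => u v uS; rewrite inE => vS.
  have bu := allP h1 _ uS; case/orP: vS => [/eqP->//|vS].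
  by have := allP h2 _ vS; move: bu => /=; lia.
have lamP : is_partition n (map fst L2).
  by rewrite /is_partition sS (perm_sumn pf) sL (perm_all _ pf) pos eqxx.
have bl : b \in parts_b (map fst L2) by rewrite mem_undup E2 mem_cat inE eqxx orbT.
have jl : (index b (parts_b (map fst L2)) < size (parts_b (map fst L2)))%N.
  by rewrite index_mem.
apply: (@orbit_of_chains _ _ _ _ y L2 (index b (parts_b (map fst L2)))) => //.
- by rewrite (perm_all _ p).
- apply/eqP; rewrite eqEsubv subvf -EL (span_chains_perm X p) //.
- exact: ltnW.
rewrite (uvec_split k lamP jl (nth_index _ bl) E2 h1 h2) Ew; congr (_ + _).
have b0 : (0 < b)%N.
  by have [_ _ /allP] := and3P lamP; apply; rewrite E2 mem_cat inE eqxx orbT.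
have lt : (sumn (map fst S1) < n)%N.
  by have [/eqP sn _ _] := and3P lamP; move: sn; rewrite E2 sumn_cat /=; lia.
(* Position [sumn (map fst S1)] in the basis is the start of the chain [x], hence its generator. *)
rewrite chains_mx_ecol // /chains map_cat flatten_cat nth_cat.
rewrite -/(chains X S1) size_chains ltnn subnn /= nth_cat size_chain Eb b0.
by rewrite (nth_map 0%N) ?size_iota ?Eb // nth_iota // expr0 -[1]/1%:M mul1mx.
Qed.

Theorem theorem3p5 (k : closedFieldType) (n : nat) :
  (* every enhanced partition gives an orbit inside the nilpotent cone *)
  (forall (lam : seq nat) (q : nat), enh_partition n lam q ->
     enh_nilcone (enh_rep k n lam q)) /\
  (* every element of the nilpotent cone lies in some O_{lam[q]} *)
  (forall x : 'M[k]_n * 'cV[k]_n, enh_nilcone x ->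
     exists (lam : seq nat) (q : nat),
       enh_partition n lam q /\ in_enh_orbit (enh_rep k n lam q) x) /\
  (* the orbits O_{lam[q]} are pairwise distinct *)
  (forall (lam1 lam2 : seq nat) (q1 q2 : nat),
     enh_partition n lam1 q1 -> enh_partition n lam2 q2 ->
     in_enh_orbit (enh_rep k n lam1 q1) (enh_rep k n lam2 q2) ->
     lam1 = lam2 /\ q1 = q2).
Proof.
split=> [lam q /andP[lamP _]|]; first by exists n; exact: jordan_mx_nilpotent.
split; [exact: enh_rep_surjective|exact: enh_rep_distinct].
Qed.
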